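(* Let $m \in \mathbb{N}$, $m\ge 1$, and let $C_a \ge 0$, $C_w \ge 0$ be real numbers. Then there exists $\tilde C_m \ge 0$ such that $$\left| w^{(i)}(\xi; M_m, N_m) \right| \le \tilde C_m\, (1 + \xi^{m-1})\, e^{\bar\Lambda^m(M_m)\, \xi}$$ for all $i \in \{0, \dots, m-1\}$, all $\xi \in [0,+\infty)$, all $M_m = (a_0,\dots,a_{m-1}) \in \Pi_m(C_a)$ and all $N_m = (w^0,\dots,w^{m-1}) \in \Pi_m(C_w)$, where $w(\cdot; M_m, N_m): [0,+\infty) \to \mathbb{C}$ is the solution to the Cauchy problem $$w^{(m)}(\xi; M_m, N_m) = a_{m-1}\, w^{(m-1)}(\xi; M_m, N_m) + \cdots + a_0\, w(\xi; M_m, N_m), \quad \xi \in (0,+\infty),$$ $$w(0; M_m, N_m) = w^0,\ \ldots,\ w^{(m-1)}(0; M_m, N_m) = w^{m-1}.$$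
   Context: For $C \ge 0$, $\Pi_m(C) := \{(x_1,\dots,x_m) \in \mathbb{C}^m : |x_1| \le C, \dots, |x_m| \le C\}$. For $M_m = (a_0,\dots,a_{m-1}) \in \mathbb{C}^m$, $\bar\Lambda^m(M_m) \in \mathbb{R}$ denotes the maximum of the real parts of the complex roots of the characteristic polynomial $\lambda^m - a_{m-1}\lambda^{m-1} - \cdots - a_1 \lambda - a_0$. $w^{(i)}(\xi; M_m, N_m)$ denotes the $i$th derivative with respect to the first argument $\xi$ (derivatives at $\xi = 0$ are one-sided). The solution of the Cauchy problem on $[0,+\infty)$ is the usual classical one, with derivatives up to order $m-1$ continuous on $[0,+\infty)$; it exists and is unique for all $M_m, N_m \in \mathbb{C}^m$. When $m=1$, $\xi^{m-1}$ means $1$ for every $\xi\ge 0$. The constant $\tilde C_m$ may depend on $m$, $C_a$, $C_w$ but not on $i$, $\xi$, $M_m$, $N_m$. *)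

(* Defs.v *)
From HB Require Import structures.
From mathcomp Require Import all_boot all_order all_algebra.
From mathcomp Require Import complex.
From mathcomp Require Import all_classical all_reals all_analysis.

Set Implicit Arguments.
Unset Strict Implicit.
Unset Printing Implicit Defensive.

Import Order.TTheory GRing.Theory Num.Theory.
Import numFieldTopology.Exports numFieldNormedType.Exports.

Local Open Scope classical_set_scope.
Local Open Scope ring_scope.

(* [Rcomplex R] is R[i] seen as an algebra over R, with the modulus as an
   R-valued norm. The instances below give it the topology of this norm, which
   makes it a normed module over R, so that the library's derivatives apply to
   functions from R to [Rcomplex R]. *)
Section Rcomplex_normedModType.
Variable R : realType.

Lemma Rcomplex_normrZ (l : R) (x : Rcomplex R) : `|l *: x| = `|l| * `|x|.
Proof.
case: x => a b; rewrite /Num.norm /= /Normc.normc /=.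
by rewrite !exprMn -mulrDr sqrtrM ?sqr_ge0// sqrtr_sqr.
Qed.

HB.instance Definition _ :=
  PseudoMetric.copy (Rcomplex R) (pseudoMetric_normed (Rcomplex R)).
HB.instance Definition _ := isPointed.Build (Rcomplex R) 0.
HB.instance Definition _ :=
  NormedZmod_PseudoMetric_eq.Build R (Rcomplex R) erefl.
HB.instance Definition _ :=
  PseudoMetricNormedZmod_Lmodule_isNormedModule.Build R (Rcomplex R)
    Rcomplex_normrZ.

End Rcomplex_normedModType.

Definition polydisc (R : realType) (m : nat) (C : R) :
    set 'rV[Rcomplex R]_m :=
  [set x | forall i, `|x 0 i| <= C].

Definition char_pol (R : realType) (m : nat) (a : 'rV[Rcomplex R]_m) :
    {poly Rcomplex R} :=
  'X^m - \sum_(i < m) a 0 i *: 'X^i.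

Definition root_real_parts (R : realType) (m : nat) (a : 'rV[Rcomplex R]_m) :
    set R :=
  [set complex.Re z | z in [set z : Rcomplex R | root (char_pol a) z]].

(* The default value 0 of [xget] is reached only for m = 0, when there is no
   root: see [max_real_partP]. *)
Definition max_real_part (R : realType) (m : nat) (a : 'rV[Rcomplex R]_m) : R :=
  xget 0 (root_real_parts a `&` ubound (root_real_parts a)).

Lemma max_real_partP (R : realType) (m : nat) (a : 'rV[Rcomplex R]_m) :
  (0 < m)%N ->
  root_real_parts a (max_real_part a) /\
  ubound (root_real_parts a) (max_real_part a).
Proof.
move=> m_gt0.
suff /(xgetPex 0) : exists x, (root_real_parts a `&` ubound (root_real_parts a)) x.
  by [].
have szS : (size (\sum_(i < m) a 0%R i *: 'X^i : {poly Rcomplex R})%R < m.+1)%N.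
  rewrite ltnS; apply: (leq_trans (size_sum _ _ _)).
  apply/bigmax_leqP => i _; apply: (leq_trans (size_scale_leq _ _)).
  by rewrite size_polyXn.
have szp : size (char_pol a) = m.+1.
  by rewrite size_polyDl ?size_polyXn ?size_polyN.
have [r rE] := closed_field_poly_normal (char_pol a).
have p0 : lead_coef (char_pol a) != 0 by rewrite lead_coef_eq0 -size_poly_eq0 szp.
have rootE z : root (char_pol a) z = (z \in r).
  by rewrite rE rootZ// root_prod_XsubC.
have [z0 z0r] : exists z0, z0 \in r.
  move: szp; rewrite rE size_scale// size_prod_XsubC => -[szr].
  by case: r szr {rE rootE} => [/= m0|z r _]; [rewrite -m0 in m_gt0|exists z; rewrite mem_head].
have [z zr zmax] : exists2 z, z \in r & forall y, y \in r -> complex.Re y <= complex.Re z.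
  have [z _ zmax] := @arg_maxP _ _ (seq_sub r) (SeqSub z0r) xpredT (fun y => complex.Re (val y)) isT.
  by exists (val z) => [|y yr]; [exact: valP|exact: (zmax (SeqSub yr))].
exists (complex.Re z); split; first by exists z => //=; rewrite rootE.
by move=> _ [y /= + <-]; rewrite rootE => /zmax.
Qed.

(* Derivative of a function on [0, +oo[, one-sided at 0. The values taken by
   [f] outside [0, +oo[ are irrelevant. *)
Definition half_derivable (R : realType) (f : R -> Rcomplex R) (x : R) : Prop :=
  if x == 0 then cvg (h^-1 *: (f h - f 0) @[h --> 0^'+]) else derivable f x 1.

Definition half_derive1 (R : realType) (f : R -> Rcomplex R) (x : R) :
    Rcomplex R :=
  if x == 0 then lim (h^-1 *: (f h - f 0) @[h --> 0^'+]) else derive1 f x.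

Definition half_derive1n (R : realType) (i : nat) (f : R -> Rcomplex R) :
    R -> Rcomplex R :=
  iter i (@half_derive1 R) f.

Record cauchy_solution (R : realType) (m : nat) (a w0 : 'rV[Rcomplex R]_m)
    (w : R -> Rcomplex R) : Prop := CauchySolution {
  cauchy_derivable : forall i x, (i.+1 < m)%N -> 0 <= x ->
    half_derivable (half_derive1n i w) x ;
  (* the derivative of order m is only required to exist on ]0, +oo[ *)
  cauchy_derivable_last : forall i x, i.+1 = m -> 0 < x ->
    half_derivable (half_derive1n i w) x ;
  cauchy_continuous : forall i, (i < m)%N ->
    {within `[0, +oo[, continuous (half_derive1n i w)} ;
  cauchy_equation : forall x, 0 < x ->
    half_derive1n m w x = \sum_(i < m) a 0 i * half_derive1n i w x ;
  cauchy_initial : forall i : 'I_m, half_derive1n i w 0 = w0 0 i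
}.

(* Main.v *)
(* Factor the characteristic polynomial as (X - z_1) ... (X - z_m); the roots
   are bounded in terms of m and Ca only. The functions u_1 = w,
   u_(k+1) = u_k' - z_k u_k satisfy first order equations
   u_k' = z_k u_k + u_(k+1) with u_(m+1) = 0 and initial values bounded
   uniformly. With L the largest Re z_k, solving them from k = m downwards costs
   one factor 1 + x at each step after the first, by the mean value theorem applied
   to exp(- z_k x) u_k. The derivatives of w are combinations of the u_k with
   bounded coefficients. *)
From HB Require Import structures.
Require Import Defs.
From mathcomp Require Import all_boot all_order all_algebra.
From mathcomp Require Import complex.
From mathcomp Require Import all_classical all_reals all_analysis.
From mathcomp Require Import ring lra.

Set Implicit Arguments.
Unset Strict Implicit.

Import Order.TTheory GRing.Theory Num.Theory.
Import numFieldTopology.Exports numFieldNormedType.Exports.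

Local Open Scope classical_set_scope.
Local Open Scope ring_scope.

(** * First order equations in real coordinates *)

(** The system is u' = (alpha + i beta) u + g with u = p + i q and g = g1 + i g2. It is kept in real
    form because the mean value theorem is applied to a real function. *)
Lemma rotation_growth_bound (R : realType) (p q g1 g2 : R -> R)
    (alpha beta L U G xi : R) :
  0 < xi -> alpha <= L -> 0 <= G ->
  {within `[0, xi], continuous p} -> {within `[0, xi], continuous q} ->
  (forall x, 0 < x < xi ->
    is_derive x 1 p (alpha * p x - beta * q x + g1 x)) ->
  (forall x, 0 < x < xi ->
    is_derive x 1 q (beta * p x + alpha * q x + g2 x)) ->
  (forall x, 0 < x < xi -> `|g1 x| <= G * expR (L * x)) ->
  (forall x, 0 < x < xi -> `|g2 x| <= G * expR (L * x)) ->
  `|p 0| <= U -> `|q 0| <= U ->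
  `|p xi| <= 2 * expR (L * xi) * (U + xi * G).
Proof.
move=> xi0 aL G0 cp cq dp dq g1G g2G p0U q0U.
pose e (x : R) := expR (- alpha * x).
pose c (x : R) := cos (beta * (x - xi)).
pose s (x : R) := sin (beta * (x - xi)).
(* [phi] is the real part of exp(- alpha x - i beta (x - xi)) (p + i q). The exponential cancels the
   homogeneous terms, so only [g1] and [g2] survive in the derivative. The phase is centred at [xi],
   where it vanishes and leaves [p xi] alone. *)
pose phi (x : R) := e x * (c x * p x + s x * q x).
have de (x : R) : is_derive x 1 e (- alpha * e x).
  by rewrite /e; apply: is_derive_eq; rewrite /GRing.scale/= ?scaler1 ?scaler0; ring.
have dc (x : R) : is_derive x 1 c (- beta * s x).
  by rewrite /c; apply: is_derive_eq; rewrite /GRing.scale/= /s; ring.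
have ds (x : R) : is_derive x 1 s (beta * c x).
  by rewrite /s; apply: is_derive_eq; rewrite /GRing.scale/= /c; ring.
have dphi (x : R) : x \in `]0, xi[ ->
    is_derive x 1 phi (e x * (c x * g1 x + s x * g2 x)).
  rewrite in_itv/= => xI.
  have := dp _ xI; have := dq _ xI => dpx dqx.
  rewrite /phi; apply: is_derive_eq.
  rewrite /GRing.scale/=; ring.
have cphi : {within `[0, xi], continuous phi}.
  have cT (f df : R -> R) : (forall x : R, is_derive x 1 f (df x)) ->
      {within `[0, xi], continuous f}.
    move=> df'; apply: continuous_subspaceT => x.
    by apply/differentiable_continuous/derivable1_diffP; case: (df' x).
  move: (cT _ _ de) (cT _ _ dc) (cT _ _ ds) => ce cc cs x.
  by apply: cvgM; [exact: ce|apply: cvgD; apply: cvgM;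
    [exact: cc|exact: cp|exact: cs|exact: cq]].
have [z] := MVT xi0 dphi cphi.
rewrite in_itv/= subr0 => zI phiE.
have [z0 zxi] := andP zI.
have c1 x : `|c x| <= 1 by rewrite ler_norml cos_geN1 cos_le1.
have s1 x : `|s x| <= 1 by rewrite ler_norml sin_geN1 sin_le1.
have pxi : p xi = expR (alpha * xi) * phi xi.
  rewrite /phi /e /c /s subrr mulr0 cos0 sin0 mul1r mul0r addr0 mulrA -expRD.
  by rewrite mulNr subrr expR0 mul1r.
have phi0 : `|phi 0| <= 2 * U.
  rewrite /phi /e mulr0 expR0 mul1r (le_trans (ler_normD _ _))// !normrM.
  have -> : 2 * U = 1 * U + 1 * U by ring.
  by apply: lerD; apply: ler_pM.
(* As [alpha <= L], the exponential of (L - alpha) z is largest at z = xi; the factor exp(alpha xi)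
   then turns it into exp(L xi). *)
have dphiG : `|e z * (c z * g1 z + s z * g2 z)| <= 2 * G * expR ((L - alpha) * xi).
  rewrite normrM ger0_norm ?expR_ge0//.
  apply: (@le_trans _ _ (e z * (2 * (G * expR (L * z))))).
    rewrite ler_wpM2l ?expR_ge0// (le_trans (ler_normD _ _))// !normrM.
    rewrite mulrDl !mul1r; apply: lerD; rewrite -[leRHS]mul1r ler_pM//.
      exact: g1G.
    exact: g2G.
  have -> : e z * (2 * (G * expR (L * z))) = 2 * G * (e z * expR (L * z)) by ring.
  rewrite ler_wpM2l ?mulr_ge0// /e -expRD ler_expR.
  have -> : - alpha * z + L * z = (L - alpha) * z by ring.
  by rewrite ler_wpM2l ?subr_ge0// ltW.
have {}phiE : phi xi = phi 0 + e z * (c z * g1 z + s z * g2 z) * xi.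
  by rewrite -phiE; ring.
rewrite pxi phiE normrM ger0_norm ?expR_ge0//.
have U0 : 0 <= U by exact: le_trans p0U.
apply: (@le_trans _ _ (expR (alpha * xi) *
    (2 * U + 2 * G * expR ((L - alpha) * xi) * xi))).
  rewrite ler_wpM2l ?expR_ge0// (le_trans (ler_normD _ _))// lerD//.
  by rewrite normrM [`|xi|]gtr0_norm// ler_wpM2r// ltW.
have EL : expR (alpha * xi) * expR ((L - alpha) * xi) = expR (L * xi).
  by rewrite -expRD; congr expR; ring.
have aLe : expR (alpha * xi) <= expR (L * xi).
  by rewrite ler_expR ler_wpM2r// ltW.
rewrite mulrDr.
have -> : expR (alpha * xi) * (2 * G * expR ((L - alpha) * xi) * xi) =
  2 * G * xi * expR (L * xi) by rewrite -EL; ring.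
have -> : 2 * expR (L * xi) * (U + xi * G) =
  expR (L * xi) * (2 * U) + 2 * G * xi * expR (L * xi) by ring.
by rewrite lerD2r ler_wpM2r// mulr_ge0.
Qed.

(** * Continuous linear maps, and the complex numbers as a real normed space *)

(** Linearity carries [l] through the difference quotients, continuity through their limit. Used for
    real and imaginary parts and for multiplication by a root. *)
Lemma is_derive_linear_comp (R : numFieldType) (U V W : normedModType R)
    (l : {linear V -> W}) (f : U -> V) (x v : U) (df : V) :
  continuous l -> is_derive x v f df -> is_derive x v (l \o f) (l df).
Proof.
move=> cl [fd fE].
have cvl : h^-1 *: (((l \o f) \o shift x) (h *: v) - (l \o f) x) @[h --> 0^']
    --> l df.
  rewrite (_ : (fun h => _) =
      l \o (fun h => h^-1 *: ((f \o shift x) (h *: v) - f x))); last first.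
    by apply/funext => h; rewrite /= [RHS]linearZ; congr (_ *: _); rewrite linearB.
  apply: (@cvg_comp _ _ _ _ l _ (nbhs df)); last exact: cl.
  by rewrite -fE; exact: fd.
by split; [apply/cvg_ex; exists (l df)|exact: cvg_lim].
Qed.

Lemma lipschitz_linear_continuous (R : numFieldType) (V W : normedModType R)
    (k : R) (l : {linear V -> W}) :
  (forall x, `|l x| <= k * `|x|) -> continuous l.
Proof.
move=> lk; apply/bounded_linear_continuous/ex_bound.
exists `|k|; have /(@nbhs0_le _ V) : (0 < 1 :> R) by [].
apply: filterS => x x1 /=.
have kx : 0 <= k * `|x| by exact: le_trans (lk x).
by rewrite (le_trans (lk x))// -(ger0_norm kx) normrM normr_id ler_piMr.
Qed.

Section Rcomplex_facts.
Variable R : realType.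
Implicit Types x y : Rcomplex R.

Lemma Rcomplex_normM x y : `|(x * y : Rcomplex R)| = `|x| * `|y|.
Proof. exact: Normc.normcM. Qed.

Lemma Rcomplex_norm1 : `|1 : Rcomplex R| = 1.
Proof. exact: Normc.normc1. Qed.

Lemma Rcomplex_normX x n : `|(x ^+ n : Rcomplex R)| = `|x| ^+ n.
Proof.
elim: n => [|n IHn]; first by rewrite !expr0 Rcomplex_norm1.
by rewrite !exprS Rcomplex_normM IHn.
Qed.

Lemma le_Re_Rcomplex_norm x : `|complex.Re x| <= `|x|.
Proof.
by case: x => a b; rewrite -sqrtr_sqr ler_wsqrtr// lerDl sqr_ge0.
Qed.

Lemma le_Im_Rcomplex_norm x : `|complex.Im x| <= `|x|.
Proof.
by case: x => a b; rewrite -sqrtr_sqr ler_wsqrtr// lerDr sqr_ge0.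
Qed.

Lemma Rcomplex_norm_le x : `|x| <= `|complex.Re x| + `|complex.Im x|.
Proof.
case: x => a b /=; rewrite [leLHS]/Num.norm/= -(ler_pXn2r (ltn0Sn 1)) ?nnegrE ?sqrtr_ge0 ?addr_ge0//.
rewrite sqr_sqrtr ?addr_ge0 ?sqr_ge0// sqrrD !real_normK ?num_real//.
by rewrite lerD2r lerDl mulrn_wge0 ?mulr_ge0.
Qed.

(** Multiplication by a fixed complex number is named so that it can carry a linear structure over
    the real field [R]. *)
Definition Rcomplex_mul (z x : Rcomplex R) : Rcomplex R := z * x.

Lemma Rcomplex_mul_is_linear z : linear (Rcomplex_mul z).
Proof.
move=> a x y; rewrite /Rcomplex_mul mulrDr; congr (_ + _).
case: z x => [z1 z2] [x1 x2]; apply/eqP; rewrite eq_complex /=.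
by apply/andP; split; apply/eqP; ring.
Qed.

HB.instance Definition _ z := GRing.isLinear.Build R (Rcomplex R) (Rcomplex R)
  _ (Rcomplex_mul z) (Rcomplex_mul_is_linear z).

Lemma Rcomplex_mul_continuous z : continuous (Rcomplex_mul z).
Proof.
apply: (@lipschitz_linear_continuous _ _ _ `|z|) => x.
by rewrite /Rcomplex_mul Rcomplex_normM.
Qed.

Lemma Re_continuous : continuous (@complex.Re R : Rcomplex R -> R).
Proof.
apply: (@lipschitz_linear_continuous _ _ _ 1) => x.
by rewrite mul1r le_Re_Rcomplex_norm.
Qed.

Lemma Im_continuous : continuous (@complex.Im R : Rcomplex R -> R).
Proof.
apply: (@lipschitz_linear_continuous _ _ _ 1) => x.
by rewrite mul1r le_Im_Rcomplex_norm.
Qed.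

End Rcomplex_facts.

(** * The first order complex equation *)

(** The real and imaginary parts of [u] each satisfy [rotation_growth_bound] with its factor 2,
    whence the 4. *)
Lemma linear_ode1_bound (R : realType) (u g : R -> Rcomplex R) (z : Rcomplex R)
    (L U G xi : R) :
  0 < xi -> complex.Re z <= L -> 0 <= G ->
  {within `[0, xi], continuous u} ->
  (forall x, 0 < x < xi -> is_derive x 1 u (z * u x + g x : Rcomplex R)) ->
  (forall x, 0 < x < xi -> `|g x| <= G * expR (L * x)) ->
  `|u 0| <= U ->
  `|u xi| <= 4 * expR (L * xi) * (U + xi * G).
Proof.
move=> xi0 zL G0 cu du gG u0U.
pose p x : R := complex.Re (u x); pose q x : R := complex.Im (u x).
pose g1 x : R := complex.Re (g x); pose g2 x : R := complex.Im (g x).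
have cp : {within `[0, xi], continuous p}.
  by move=> x; apply: continuous_comp; [exact: cu|exact: Re_continuous].
have cq : {within `[0, xi], continuous q}.
  by move=> x; apply: continuous_comp; [exact: cu|exact: Im_continuous].
have dp x : 0 < x < xi -> is_derive x 1 p
    (complex.Re z * p x - complex.Im z * q x + g1 x).
  move=> /du du'; have := is_derive_linear_comp (@Re_continuous R) du'.
  by rewrite /p /q /g1; case: z (u x) (g x) {zL du du'} => a b [? ?] [? ?].
have dq x : 0 < x < xi -> is_derive x 1 q
    (complex.Im z * p x + complex.Re z * q x + g2 x).
  move=> /du du'; apply: is_derive_eq.
    exact: (is_derive_linear_comp (@Im_continuous R) du').
  by rewrite /p /q /g2; case: z (u x) (g x) {zL du du' dp} => a b [? ?] [? ?] /=; ring.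
have g1G x : 0 < x < xi -> `|g1 x| <= G * expR (L * x).
  by move=> /gG; exact/le_trans/le_Re_Rcomplex_norm.
have g2G x : 0 < x < xi -> `|g2 x| <= G * expR (L * x).
  by move=> /gG; exact/le_trans/le_Im_Rcomplex_norm.
have p0 : `|p 0| <= U by exact/le_trans/u0U/le_Re_Rcomplex_norm.
have q0 : `|q 0| <= U by exact/le_trans/u0U/le_Im_Rcomplex_norm.
have pxi := rotation_growth_bound xi0 zL G0 cp cq dp dq g1G g2G p0 q0.
(* Exchanging real and imaginary parts reverses the rotation. *)
have dq' x : 0 < x < xi -> is_derive x 1 q
    (complex.Re z * q x - (- complex.Im z) * p x + g2 x).
  by move=> /dq; rewrite mulNr opprK [X in X + _]addrC.
have dp' x : 0 < x < xi -> is_derive x 1 p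
    (- complex.Im z * q x + complex.Re z * p x + g1 x).
  by move=> /dp; rewrite mulNr [X in X + _]addrC.
have qxi := rotation_growth_bound xi0 zL G0 cq cp dq' dp' g2G g1G q0 p0.
apply: (le_trans (Rcomplex_norm_le _)).
have -> : 4 * expR (L * xi) * (U + xi * G) =
  2 * expR (L * xi) * (U + xi * G) + 2 * expR (L * xi) * (U + xi * G) by ring.
exact: lerD.
Qed.

(** * Splitting off the roots one at a time *)

(** When [c i] is the derivative of order i of a function w, this says that the operator of ('X - z)
    q applied to w is the operator of q applied to w' - z w. *)
Lemma sum_coef_mulXsubC (S : comNzRingType) (n : nat) (z : S) (q : {poly S})
    (c : nat -> S) :
  (size q <= n.+1)%N ->
  \sum_(i < n.+2) (('X - z%:P) * q)`_i * c i =
  \sum_(i < n.+1) q`_i * (c i.+1 - z * c i).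
Proof.
move=> qn.
under eq_bigr do rewrite mulrBl coefB coefXM coefCM mulrBl.
under [RHS]eq_bigr do rewrite mulrBr.
rewrite !sumrB big_ord_recl/= mul0r add0r; congr (_ - _).
rewrite big_ord_recr/= nth_default// mulr0 mul0r addr0.
by apply: eq_bigr => i _; rewrite mulrCA mulrA.
Qed.

(* The factor [(0 < n)%:R] makes the bound vanish for [n = 0], where the
   equation reads [f 0 = 0] and [n.-1] is truncated. *)
Lemma factored_ode_bound (R : realType) (n : nat) (B : R) : 0 <= B ->
  exists2 D : R, 0 <= D &
  forall (s : seq (Rcomplex R)) (L K : R) (f : nat -> R -> Rcomplex R),
  size s = n -> 0 <= K ->
  (forall z, z \in s -> complex.Re z <= L /\ `|z| <= B) ->
  (forall i, (i < n)%N -> {within `[0, +oo[, continuous (f i)}) ->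
  (forall i (x : R), (i < n)%N -> 0 < x -> is_derive x 1 (f i) (f i.+1 x)) ->
  (forall x, 0 < x ->
    \sum_(i < n.+1) (\prod_(z <- s) ('X - z%:P))`_i * f i x = 0) ->
  (forall i, (i < n)%N -> `|f i 0| <= K) ->
  forall i x, (i <= n)%N -> 0 < x ->
    `|f i x| <= K * D * ((0 < n)%:R * (1 + x) ^+ n.-1) * expR (L * x).
Proof.
move=> B0; elim: n => [|n [D D0 IH]].
  exists 0 => // s L K f /size0nil -> K0 _ _ _ f0 _ [|//] x _ x0.
  have := f0 _ x0; rewrite big_nil big_ord_recl big_ord0 addr0 coef1/= mul1r => ->.
  by rewrite mulr0 !mul0r normr0.
(* [linear_ode1_bound] will be used with U = K and G = (1 + B) K D E(x), and 4 (U + x G) is then at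
   most K A (1 + x)^n. *)
pose A := 4 * (1 + (1 + B) * D).
have B1 : 0 <= 1 + B by rewrite addr_ge0.
have A0 : 0 <= A by rewrite !(mulr_ge0, addr_ge0).
have DA : (1 + B) * D <= A.
  have := mulr_ge0 B1 D0; rewrite /A; lra.
exists (A * (1 + B) ^+ n.+1); first by rewrite mulr_ge0// exprn_ge0.
move=> [//|z s] L K f [sn] K0 sB cf df f0 fK.
have [zL zB] := sB z (mem_head _ _).
(* [g i] plays the derivative of order i of f' - z f, which solves the equation for the remaining
   roots [s], with initial values at most (1 + B) K. *)
pose g i x : Rcomplex R := f i.+1 x - z * f i x.
pose E (x : R) : R := (0 < n)%:R * (1 + x) ^+ n.-1.
have E_ge0 x : 0 <= x -> 0 <= E x.
  by move=> x0; rewrite mulr_ge0// exprn_ge0// addr_ge0.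
(* For n = 0 the left side is 0: the source [g 0] vanishes, so the first integration costs no power
   of 1 + x. This is why n roots yield only the exponent n - 1. *)
have E_le x : 0 <= x -> E x * (1 + x) <= (1 + x) ^+ n.
  rewrite /E; case: n {IH sn cf df f0 fK E E_ge0} => [|n] x0; last first.
    by rewrite mul1r exprSr.
  by rewrite !mul0r.
have gE i x : (i <= n)%N -> 0 < x ->
    `|g i x| <= (1 + B) * K * D * E x * expR (L * x).
  apply: (IH s L ((1 + B) * K) g) => //.
  - by rewrite mulr_ge0.
  - by move=> y ys; apply: sB; rewrite inE ys orbT.
  - move=> j jn y; apply: cvgD; first by apply: cf.
    apply: cvgN; apply: (@continuous_comp _ _ _ _ (Rcomplex_mul z)).
      by apply: cf; exact: ltnW.
    exact: Rcomplex_mul_continuous.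
  - move=> j y jn y0; apply: is_deriveB; first by apply: df.
    apply: (is_derive_linear_comp (l := Rcomplex_mul z)).
      exact: Rcomplex_mul_continuous.
    by apply: df => //; exact: ltnW.
  - move=> y y0; rewrite -[RHS](f0 _ y0) big_cons (sum_coef_mulXsubC z (f^~ y))//.
    by rewrite size_prod_XsubC sn.
  - move=> j jn; rewrite (le_trans (ler_normB _ _))// Rcomplex_normM.
    rewrite mulrDl mul1r lerD ?fK// ler_pM//.
    by apply: fK; exact: ltnW.
have f0E x : 0 < x -> `|f 0 x| <= K * A * (1 + x) ^+ n * expR (L * x).
  move=> x0; have x0' := ltW x0.
  (* The source bound must have a constant coefficient on ]0, x[; as [E] is nondecreasing, its value
     at the right end serves. *)
  have G0 : 0 <= (1 + B) * K * D * E x by rewrite mulr_ge0 ?E_ge0// !mulr_ge0.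
  have : `|f 0 x| <= 4 * expR (L * x) * (K + x * ((1 + B) * K * D * E x)).
    apply: (@linear_ode1_bound _ (f 0) (g 0) z) => //.
    - apply: continuous_subspaceW; last exact: cf.
      by move=> y /=; rewrite !in_itv/= andbT => /andP[].
    - move=> y /andP[y0 _]; have -> : z * f 0 y + g 0 y = f 1 y.
        by rewrite /g addrC subrK.
      exact: df.
    - move=> y /andP[y0 yx]; apply: (le_trans (gE _ _ (leq0n _) y0)).
      rewrite ler_wpM2r ?expR_ge0// ler_wpM2l ?mulr_ge0//.
      rewrite /E ler_wpM2l// lerXn2r ?nnegrE ?addr_ge0// ?(ltW y0)//.
      by rewrite lerD2l ltW.
    - exact: fK.
  move=> /le_trans; apply.
  rewrite [leRHS]mulrC -[4 * _]mulrC -[expR _ * 4 * _]mulrA.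
  rewrite ler_wpM2l ?expR_ge0//.
  have X1 : 1 <= (1 + x) ^+ n by rewrite exprn_ege1// lerDl.
  have xE : x * E x <= (1 + x) ^+ n.
    rewrite (le_trans _ (E_le _ x0'))// mulrC ler_wpM2l ?E_ge0//.
    by rewrite lerDr.
  have -> : K * A * (1 + x) ^+ n =
    4 * (K * (1 + x) ^+ n + (1 + B) * K * D * (1 + x) ^+ n) by rewrite /A; ring.
  rewrite ler_wpM2l//.
  have -> : x * ((1 + B) * K * D * E x) = (1 + B) * K * D * (x * E x) by ring.
  apply: lerD; first by rewrite ler_peMr.
  by rewrite ler_wpM2l// !mulr_ge0.
(* Higher orders follow from [f i.+1 = g i + z * f i]: both terms are controlled by the bound at
   order i, with factors 1 and B, so each order costs a factor 1 + B. *)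
have fE i x : (i <= n.+1)%N -> 0 < x ->
    `|f i x| <= K * (A * (1 + B) ^+ i) * (1 + x) ^+ n * expR (L * x).
  elim: i => [|i IHi] iN x0; first by rewrite expr0 mulr1 f0E.
  have x0' := ltW x0.
  have -> : f i.+1 x = g i x + z * f i x by rewrite /g subrK.
  rewrite (le_trans (ler_normD _ _))// Rcomplex_normM.
  have gi := gE i x iN x0; have fi := IHi (ltnW iN) x0.
  set Y := (1 + x) ^+ n in fi *; set e := expR (L * x) in gi fi *.
  have e0 : 0 <= e by rewrite expR_ge0.
  have Y0 : 0 <= Y by rewrite exprn_ge0// addr_ge0.
  have EY : E x <= Y.
    rewrite (le_trans _ (E_le _ x0'))// ler_peMr ?E_ge0// lerDl//.
  have {}gi : `|g i x| <= K * A * (1 + B) ^+ i * Y * e.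
    apply: (le_trans gi); rewrite ler_wpM2r//.
    apply: ler_pM => //; [by rewrite !mulr_ge0|exact: E_ge0|].
    have -> : (1 + B) * K * D = K * ((1 + B) * D) by ring.
    rewrite -[leRHS]mulrA ler_wpM2l// (le_trans DA)// ler_peMr//.
    by rewrite exprn_ege1// lerDl.
  have {}fi : `|z| * `|f i x| <= B * (K * A * (1 + B) ^+ i * Y * e).
    rewrite ler_pM// (le_trans fi)// mulrA//.
  have -> : K * (A * (1 + B) ^+ i.+1) * Y * e =
    K * A * (1 + B) ^+ i * Y * e + B * (K * A * (1 + B) ^+ i * Y * e).
    by rewrite exprS; ring.
  exact: lerD.
move=> i x iN x0; rewrite mul1r/=.
apply: (le_trans (fE i x iN x0)).
rewrite ler_wpM2r ?expR_ge0// ler_wpM2r ?exprn_ge0 ?addr_ge0 ?(ltW x0)//.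
rewrite ler_wpM2l// ler_wpM2l// ler_weXn2l// lerDl//.
Qed.

(** [1 + x] is at most 2 or 2 x according to the side of 1 on which x lies. This turns the power
    produced by the induction into the form required in the theorem. *)
Lemma exp1D_le (R : realFieldType) (k : nat) (x : R) :
  0 <= x -> (1 + x) ^+ k <= 2 ^+ k * (1 + x ^+ k).
Proof.
move=> x0; have xk0 : 0 <= x ^+ k by rewrite exprn_ge0.
have [x1|/ltW x1] := leP x 1.
  apply: (@le_trans _ _ (2 ^+ k)); last by rewrite ler_peMr ?exprn_ge0// lerDl.
  by apply: lerXn2r; rewrite ?nnegrE; lra.
apply: (@le_trans _ _ ((2 * x) ^+ k)); first by apply: lerXn2r; rewrite ?nnegrE; lra.
by rewrite exprMn ler_wpM2l ?exprn_ge0// lerDr.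
Qed.

(** * Coefficients, factorisation and roots of the characteristic polynomial *)

Section characteristic_polynomial.
Variables (R : realType) (m : nat) (a : 'rV[Rcomplex R]_m).

Lemma coef_char_pol i :
  (char_pol a)`_i = (i == m)%:R - \sum_(j < m) a 0 j * (i == j)%:R.
Proof.
rewrite coefB coefXn coef_sum; congr (_ - _).
by apply: eq_bigr => j _; rewrite coefZ coefXn.
Qed.

(** Taking for [c] the successive derivatives of a solution makes the right side vanish; this links
    [cauchy_equation] to the coefficient form in [factored_ode_bound]. *)
Lemma sum_coef_char_pol (c : nat -> Rcomplex R) :
  \sum_(i < m.+1) (char_pol a)`_i * c i = c m - \sum_(i < m) a 0 i * c i.
Proof.
rewrite big_ord_recr/= coef_char_pol eqxx.
rewrite [X in _ - X]big1 ?subr0 ?mul1r => [|j _]; last first.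
  by rewrite gtn_eqF// mulr0.
rewrite addrC -sumrN; congr (_ + _); apply: eq_bigr => i _.
rewrite coef_char_pol ltn_eqF// sub0r (bigD1 i)//= eqxx mulr1.
rewrite big1 ?addr0 ?mulNr// => j ji.
by rewrite -[(_ == _ :> nat)]/(i == j) eq_sym (negbTE ji) mulr0.
Qed.

Lemma char_pol_factor :
  exists2 s : seq (Rcomplex R),
    char_pol a = \prod_(z <- s) ('X - z%:P) & size s = m.
Proof.
have szS : (size (\sum_(i < m) a 0 i *: 'X^i : {poly Rcomplex R})%R <= m)%N.
  apply: (leq_trans (size_sum _ _ _)); apply/bigmax_leqP => i _.
  by apply: (leq_trans (size_scale_leq _ _)); rewrite size_polyXn.
have szp : size (char_pol a) = m.+1.
  by rewrite size_polyDl ?size_polyXn ?size_polyN.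
have lcp : lead_coef (char_pol a) = 1.
  by rewrite lead_coefDl ?lead_coefXn// size_polyN size_polyXn.
have [s sE] := closed_field_poly_normal (char_pol a).
rewrite lcp scale1r in sE.
exists s => //; move: szp; rewrite sE size_prod_XsubC => -[//].
Qed.

(** A root beyond the bound would have modulus above 1, so all its powers below m would be dominated
    by the power m - 1; the equation would then force its modulus below m C. *)
Lemma root_char_pol_norm (C : R) (z : Rcomplex R) :
  0 <= C -> polydisc C a -> root (char_pol a) z -> `|z| <= 1 + m%:R * C.
Proof.
move=> C0 aC /rootP; rewrite /char_pol hornerD hornerN hornerXn horner_sum.
move=> /eqP; rewrite subr_eq0 => /eqP zm.
rewrite leNgt; apply/negP => zC.
have mC0 : 0 <= m%:R * C by rewrite mulr_ge0.
have z1 : 1 < `|z| by apply: le_lt_trans zC; rewrite lerDl.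
have : `|z| ^+ m <= m%:R * C * `|z| ^+ m.-1.
  rewrite -Rcomplex_normX zm (le_trans (ler_norm_sum _ _ _))//.
  rewrite (_ : m%:R * C * _ = \sum_(i < m) (C * `|z| ^+ m.-1)).
    apply: ler_sum => i _; rewrite hornerZ hornerXn Rcomplex_normM Rcomplex_normX.
    rewrite ler_pM ?exprn_ge0//.
    by rewrite ler_weXn2l ?(ltW z1)// -ltnS prednK// (leq_ltn_trans _ (ltn_ord i)).
  by rewrite sumr_const card_ord -[RHS]mulr_natl mulrA.
apply/negP; rewrite -ltNge.
(* For m = 0 the polynomial is 1 and [zm] reads 1 = 0. *)
move: zm; case: m a aC zC mC0 => [|k] b _ zC mC0 zm.
  move: zm; rewrite big_ord0 expr0 => /eqP; rewrite oner_eq0//.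
have z0 : 0 < `|z| by exact: lt_trans z1.
rewrite exprS/= ltr_pM2r ?exprn_gt0//.
by apply: lt_trans zC; rewrite ltrDr.
Qed.

End characteristic_polynomial.

Unset Implicit Arguments.

(** * The uniform estimate for the Cauchy problem *)

Theorem proposition1 (R : realType) (m : nat) (m_ge1 : (1 <= m)%N)
    (Ca Cw : R) (Ca_ge0 : 0 <= Ca) (Cw_ge0 : 0 <= Cw) :
  exists Cm : R, 0 <= Cm /\
    forall (i : 'I_m) (xi : R) (M N : 'rV[Rcomplex R]_m) (w : R -> Rcomplex R),
      0 <= xi -> polydisc Ca M -> polydisc Cw N -> cauchy_solution M N w ->
      `|half_derive1n i w xi| <=
        Cm * (1 + xi ^+ m.-1) * expR (max_real_part M * xi).
Proof.
(* [B] bounds the roots for every [M] in the polydisc at once, so [D] is fixed before [M]. *)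
pose B : R := 1 + m%:R * Ca.
have B0 : 0 <= B by rewrite addr_ge0// mulr_ge0.
have [D D0 bound] := factored_ode_bound m B0.
(* The summand [Cw] covers xi = 0, where the initial values give the bound; the other covers xi > 0,
   its power of 2 coming from [exp1D_le]. *)
exists (Cw + Cw * D * 2 ^+ m.-1); split.
  by rewrite addr_ge0// !mulr_ge0// exprn_ge0.
move=> i xi M N w xi0 MC NC [wd wdl wc weq w0].
have w0N j : (j < m)%N -> `|half_derive1n j w 0| <= Cw.
  by move=> jm; rewrite (w0 (Ordinal jm)); exact: NC.
have P1 : 1 <= 1 + xi ^+ m.-1 by rewrite lerDl exprn_ge0.
have CwD : 0 <= Cw * D * 2 ^+ m.-1 by rewrite !mulr_ge0// exprn_ge0.
move: xi0; rewrite le_eqVlt => /predU1P[xi0|xi_gt0].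
  rewrite -xi0 in P1 *; rewrite mulr0 expR0 mulr1 (le_trans (w0N _ (ltn_ord i)))//.
  by rewrite (@le_trans _ _ (Cw + Cw * D * 2 ^+ m.-1)) ?lerDl// ler_peMr// addr_ge0.
have [s sE szs] := char_pol_factor M.
have [_ Mub] := max_real_partP M m_ge1.
have zM z : z \in s -> complex.Re z <= max_real_part M /\ `|z| <= B.
  rewrite -root_prod_XsubC -sE => zr; split; last exact: root_char_pol_norm.
  by apply: Mub; exists z.
(* Away from 0 the one-sided derivative is the ordinary one. The order j = m - 1 relies on
   [cauchy_derivable_last], the lower ones on [cauchy_derivable]. *)
have wD j (x : R) : (j < m)%N -> 0 < x ->
    is_derive x 1 (half_derive1n j w) (half_derive1n j.+1 w x).
  move=> jm x0.
  have : half_derivable (half_derive1n j w) x.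
    move: (jm); rewrite leq_eqVlt => /predU1P[jm'|jm']; first exact: wdl.
    by apply: wd => //; exact: ltW.
  rewrite /half_derivable gt_eqF// => dj; apply: DeriveDef => //.
  by rewrite /half_derive1n iterS /half_derive1 gt_eqF// derive1E.
have wE x : 0 < x ->
    \sum_(j < m.+1) (\prod_(z <- s) ('X - z%:P))`_j * half_derive1n j w x = 0.
  move=> x0; rewrite -sE.
  by rewrite (sum_coef_char_pol M (fun j => half_derive1n j w x)) weq// subrr.
have := bound s (max_real_part M) Cw (fun j => half_derive1n j w)
  szs Cw_ge0 zM wc wD wE w0N i xi (ltnW (ltn_ord i)) xi_gt0.
move=> /le_trans; apply; rewrite ler_wpM2r ?expR_ge0// m_ge1 mul1r.
apply: (@le_trans _ _ (Cw * D * 2 ^+ m.-1 * (1 + xi ^+ m.-1))).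
  by rewrite -[leRHS]mulrA ler_wpM2l ?mulr_ge0// exp1D_le// ltW.
by rewrite ler_wpM2r ?lerDr// (le_trans _ P1).
Qed.
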